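(* Let $Q$ and $Q'$ be quivers, let $d=(d_a)_{a\in Q_0}\in\mathbf{N}^{Q_0}$ and $d'=(d'_{a'})_{a'\in Q'_0}\in\mathbf{N}^{Q'_0}$ be fixed non-zero dimension vectors, and let $\tilde Q$, $\tilde{Q'}$ and $\widetilde{Q\otimes Q'}$ be the covering quivers of $Q$, $Q'$ and $Q\otimes Q'$ with respect to the dimension vectors $d$, $d'$ and $\bar d=(d_ad'_{a'})_{(a,a')\in Q_0\times Q'_0}$ respectively. Then the quiver $\tilde Q\otimes\tilde{Q'}$ is isomorphic to a subquiver of $\widetilde{Q\otimes Q'}$ in the category $\mathbf{Quiv}$ of quivers.
   Context: A quiver $Q=(Q_0,Q_1,\mathrm{s}_Q,\mathrm{t}_Q)$ consists of finite sets $Q_0\neq\emptyset$ (vertices), $Q_1$ (arrows) and maps $\mathrm{s}_Q,\mathrm{t}_Q:Q_1\to Q_0$. A morphism $Q\to Q'$ in $\mathbf{Quiv}$ is a pair $\phi=(\phi_0,\phi_1)$ of functions $\phi_0:Q_0\to Q_0'$, $\phi_1:Q_1\to Q_1'$ with $\phi_0(\mathrm{s}_Q(\alpha))=\mathrm{s}_{Q'}(\phi_1(\alpha))$ and $\phi_0(\mathrm{t}_Q(\alpha))=\mathrm{t}_{Q'}(\phi_1(\alpha))$ for all $\alpha\in Q_1$; it is an isomorphism if $\phi_0,\phi_1$ are bijections. The covering quiver $\tilde Q$ of $Q$ with respect to $d\in\mathbf{N}^{Q_0}$ has vertices $\tilde Q_0=\{(a,\mu)\in Q_0\times\mathbf{N}\mid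 1\le\mu\le d_a\}$ and arrows $\tilde Q_1=\{(\alpha,\mu,\nu)\in Q_1\times\mathbf{N}\times\mathbf{N}\mid 1\le\mu\le d_{\mathrm{s}_Q(\alpha)},\ 1\le\nu\le d_{\mathrm{t}_Q(\alpha)}\}$, with $\mathrm{s}_{\tilde Q}(\alpha,\mu,\nu)=(\mathrm{s}_Q(\alpha),\mu)$ and $\mathrm{t}_{\tilde Q}(\alpha,\mu,\nu)=(\mathrm{t}_Q(\alpha),\nu)$. The internal product $Q\otimes Q'$ has vertex set $Q_0\times Q'_0$ and arrow set $(Q_0\times Q'_1)\sqcup(Q_1\times Q'_0)$; an arrow $(a,\alpha')\in Q_0\times Q_1'$ goes from $(a,\mathrm{s}_{Q'}(\alpha'))$ to $(a,\mathrm{t}_{Q'}(\alpha'))$, and an arrow $(\alpha,a')\in Q_1\times Q_0'$ goes from $(\mathrm{s}_Q(\alpha),a')$ to $(\mathrm{t}_Q(\alpha),a')$. *)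

(* Defs.v *)
From HB Require Import structures.
From mathcomp Require Import all_boot.

Set Implicit Arguments.
Unset Strict Implicit.
Unset Printing Implicit Defensive.

Record quiver : Type := Quiver {
  vertex : finType;
  arrow : finType;
  source : arrow -> vertex;
  target : arrow -> vertex;
  vertex_neq0 : 0 < #|vertex|
}.

Record quiver_hom (Q Q' : quiver) : Type := QuiverHom {
  hom_vertex : vertex Q -> vertex Q';
  hom_arrow : arrow Q -> arrow Q';
  hom_source : forall x, hom_vertex (source x) = source (hom_arrow x);
  hom_target : forall x, hom_vertex (target x) = target (hom_arrow x)
}.

Definition is_quiver_iso (Q Q' : quiver) (phi : quiver_hom Q Q') : Prop :=
  bijective (hom_vertex phi) /\ bijective (hom_arrow phi).

Definition quiver_isomorphic (Q Q' : quiver) : Prop :=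
  exists phi : quiver_hom Q Q', is_quiver_iso phi.

(* A subquiver is itself a quiver, so its vertex set has to be nonempty. *)
Record subquiver (Q : quiver) : Type := Subquiver {
  sub_vertex : {set vertex Q};
  sub_arrow : {set arrow Q};
  sub_vertex_neq0 : 0 < #|sub_vertex|;
  sub_source : forall x, x \in sub_arrow -> source x \in sub_vertex;
  sub_target : forall x, x \in sub_arrow -> target x \in sub_vertex
}.

Section SubquiverQuiver.
Variables (Q : quiver) (S : subquiver Q).

Lemma subquiver_vertex_neq0 : 0 < #|{: {a : vertex Q | a \in sub_vertex S}}|.
Proof. by rewrite card_sig sub_vertex_neq0. Qed.

Definition quiver_of_subquiver : quiver :=
  @Quiver {a : vertex Q | a \in sub_vertex S} {x : arrow Q | x \in sub_arrow S}
    (fun x => exist _ (source (sval x)) (sub_source (svalP x)))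
    (fun x => exist _ (target (sval x)) (sub_target (svalP x)))
    subquiver_vertex_neq0.

End SubquiverQuiver.

Definition dim_vector (Q : quiver) : Type := vertex Q -> nat.

Definition dim_neq0 (Q : quiver) (d : dim_vector Q) : Prop :=
  exists a, d a <> 0.

Section Covering.
Variables (Q : quiver) (d : dim_vector Q) (d_neq0 : dim_neq0 d).

(* The index 1 <= mu <= d a is encoded as the element mu - 1 of 'I_(d a). *)
Definition covering_vertex : finType := {a : vertex Q & 'I_(d a)}.

Definition covering_arrow : finType :=
  {x : arrow Q & 'I_(d (source x)) * 'I_(d (target x))}%type.

Definition covering_source (x : covering_arrow) : covering_vertex :=
  Tagged (fun a => 'I_(d a)) (tagged x).1.

Definition covering_target (x : covering_arrow) : covering_vertex :=
  Tagged (fun a => 'I_(d a)) (tagged x).2.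

Lemma covering_vertex_neq0 : 0 < #|covering_vertex|.
Proof.
have [a /eqP] := d_neq0; rewrite -lt0n => da_gt0.
by apply/card_gt0P; exists (Tagged (fun a => 'I_(d a)) (Ordinal da_gt0)).
Qed.

(* The covering of the zero dimension vector would have no vertices, hence
   would not be a quiver. *)
Definition covering : quiver :=
  Quiver covering_source covering_target covering_vertex_neq0.

End Covering.

Section Tensor.
Variables Q Q' : quiver.

Definition tensor_vertex : finType := (vertex Q * vertex Q')%type.

Definition tensor_arrow : finType :=
  (vertex Q * arrow Q' + arrow Q * vertex Q')%type.

Definition tensor_source (x : tensor_arrow) : tensor_vertex :=
  match x with
  | inl (a, x') => (a, source x')
  | inr (x, a') => (source x, a')
  end.

Definition tensor_target (x : tensor_arrow) : tensor_vertex :=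
  match x with
  | inl (a, x') => (a, target x')
  | inr (x, a') => (target x, a')
  end.

Lemma tensor_vertex_neq0 : 0 < #|tensor_vertex|.
Proof. by rewrite card_prod muln_gt0 !vertex_neq0. Qed.

Definition tensor : quiver :=
  Quiver tensor_source tensor_target tensor_vertex_neq0.

Definition tensor_dim (d : dim_vector Q) (d' : dim_vector Q') :
  dim_vector tensor := fun a => d a.1 * d' a.2.

Lemma tensor_dim_neq0 (d : dim_vector Q) (d' : dim_vector Q') :
  dim_neq0 d -> dim_neq0 d' -> dim_neq0 (tensor_dim d d').
Proof.
move=> [a /eqP da] [a' /eqP da']; exists (a, a'); apply/eqP.
by rewrite muln_eq0 negb_or da.
Qed.

End Tensor.

(* Main.v *)
(**
  Identify a pair of indices (mu, mu') in [1, d_a] x [1, d'_a'] with a single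
  index in [1, d_a d'_a']. On vertices this is a bijection; on arrows an arrow
  ((a, mu), (alpha', nu, nu')) goes to
  ((a, alpha'), (mu, nu), (mu, nu')), which is injective but in general not
  surjective, since the first components of the two indices at its ends
  agree. An injective morphism is an isomorphism onto its image.
*)

Require Import Defs.
From mathcomp Require Import all_boot matrix.

Set Implicit Arguments.
Unset Strict Implicit.
Unset Printing Implicit Defensive.

(** [mxvec_index], which numbers the entries of a matrix, serves to merge two indices into one; it
    is injective because it has a left inverse on pairs. *)
Lemma mxvec_index_inj (m n : nat) (i i' : 'I_m) (j j' : 'I_n) :
  mxvec_index i j = mxvec_index i' j' -> (i, j) = (i', j').
Proof.
have [g idxK _] := curry_mxvec_bij m n => eq_idx.
by rewrite -(idxK (i, j)) ?inE // -(idxK (i', j')) ?inE //= eq_idx.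
Qed.

(** Comparing second components over one tag rests on uniqueness of identity proofs, available
    because equality on [I] is decidable. *)
Lemma Tagged_inj (I : eqType) (T_ : I -> eqType) (i : I) :
  injective (Tagged T_ : T_ i -> {i : I & T_ i}).
Proof. by move=> x y /eqP; rewrite eq_Tagged => /eqP. Qed.

Section Image.
Variables (Q Q' : quiver) (phi : quiver_hom Q Q').

Lemma image_vertex_neq0 : 0 < #|hom_vertex phi @: setT|.
Proof.
have /card_gt0P[a _] := vertex_neq0 Q.
by apply/card_gt0P; exists (hom_vertex phi a); rewrite imset_f.
Qed.

Lemma image_source y :
  y \in hom_arrow phi @: setT -> source y \in hom_vertex phi @: setT.
Proof. by case/imsetP=> x _ ->; rewrite -hom_source imset_f. Qed.

Lemma image_target y :
  y \in hom_arrow phi @: setT -> target y \in hom_vertex phi @: setT.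
Proof. by case/imsetP=> x _ ->; rewrite -hom_target imset_f. Qed.

Definition image_subquiver : subquiver Q' :=
  Subquiver image_vertex_neq0 image_source image_target.

End Image.

(** An injection between finite types of equal cardinality is bijective, so no inverse is
    constructed. *)
Lemma inj_corestrict_bij (A B : finType) (f : A -> B)
    (fP : forall x, f x \in f @: setT) :
  injective f ->
  bijective (fun x => exist (fun y => y \in f @: setT) (f x) (fP x)).
Proof.
move=> f_inj; apply: inj_card_bij => [x y [] /f_inj //|].
by rewrite card_sig card_imset // cardsT.
Qed.

Lemma inj_hom_isomorphic_image (Q Q' : quiver) (phi : quiver_hom Q Q') :
  injective (hom_vertex phi) -> injective (hom_arrow phi) ->
  quiver_isomorphic Q (quiver_of_subquiver (image_subquiver phi)).
Proof.
move=> vI aI.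
have vP x : hom_vertex phi x \in hom_vertex phi @: setT by rewrite imset_f.
have aP x : hom_arrow phi x \in hom_arrow phi @: setT by rewrite imset_f.
pose S := quiver_of_subquiver (image_subquiver phi).
pose fv x : vertex S := exist _ (hom_vertex phi x) (vP x).
pose fa x : arrow S := exist _ (hom_arrow phi x) (aP x).
(* Elements of a subquiver are equal once their underlying values are, so both compatibilities come
   from those of [phi]. *)
have fS x : fv (source x) = source (fa x) by apply: val_inj; apply: hom_source.
have fT x : fv (target x) = target (fa x) by apply: val_inj; apply: hom_target.
exists (QuiverHom fS fT).
by split; apply: inj_corestrict_bij.
Qed.

Section TensorCovering.
Variables (Q Q' : quiver) (d : dim_vector Q) (d' : dim_vector Q').
Hypotheses (d_neq0 : dim_neq0 d) (d'_neq0 : dim_neq0 d').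

Let QtQ' := tensor (covering d_neq0) (covering d'_neq0).
Let QQ't := covering (tensor_dim_neq0 d_neq0 d'_neq0).

Definition tensor_covering_vertex (u : vertex QtQ') : vertex QQ't :=
  Tagged (fun a => 'I_(tensor_dim d d' a))
    (mxvec_index (tagged u.1) (tagged u.2)
     : 'I_(tensor_dim d d' (tag u.1, tag u.2))).

(** [T_] is the family of index pairs underlying [covering_arrow]; at each tag its ordinal types
    compute to those of the [mxvec_index] values. *)
Definition tensor_covering_arrow (u : arrow QtQ') : arrow QQ't :=
  let T_ (x : arrow (tensor Q Q')) :=
    ('I_(tensor_dim d d' (source x)) * 'I_(tensor_dim d d' (target x)))%type in
  match u with
  | inl (v, w) =>
      @Tagged _ (inl (tag v, tag w)) T_
        (mxvec_index (tagged v) (tagged w).1,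
         mxvec_index (tagged v) (tagged w).2)
  | inr (w, v) =>
      @Tagged _ (inr (tag w, tag v)) T_
        (mxvec_index (tagged w).1 (tagged v),
         mxvec_index (tagged w).2 (tagged v))
  end.

Lemma tensor_covering_source u :
  tensor_covering_vertex (source u) = source (tensor_covering_arrow u).
Proof. by case: u => [[[a mu] [x nu]]|[[x nu] [a mu]]]. Qed.

Lemma tensor_covering_target u :
  tensor_covering_vertex (target u) = target (tensor_covering_arrow u).
Proof. by case: u => [[[a mu] [x nu]]|[[x nu] [a mu]]]. Qed.

Definition tensor_covering_hom : quiver_hom QtQ' QQ't :=
  QuiverHom tensor_covering_source tensor_covering_target.

Lemma tensor_covering_vertex_inj : injective tensor_covering_vertex.
Proof.
move=> [[a mu] [a' mu']] [[b nu] [b' nu']] E.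
(* Eliminating the equalities of tags puts the indices over the same vertices, where [Tagged_inj]
   applies. *)
have [/= Ea Ea'] := congr1 tag E; case: b / Ea nu E => nu.
case: b' / Ea' nu' => nu' /Tagged_inj /mxvec_index_inj /= E.
by case: E => -> ->.
Qed.

Lemma tensor_covering_arrow_inj : injective tensor_covering_arrow.
Proof.
(* The mixed cases are impossible: the tags of the images are built with different constructors. *)
move=> [[[a mu] [x nu]]|[[x nu] [a mu]]] [[[b ka] [y la]]|[[y la] [b ka]]] E //=.
- have [/= Ea Ex] := congr1 tag E; case: b / Ea ka E => ka.
  case: y / Ex la => la /Tagged_inj E.
  (* [E1] yields the index of the vertex and the source index of the arrow; [E2] adds the target
     index. *)
  have /= /mxvec_index_inj E1 := congr1 fst E.
  have /= /mxvec_index_inj E2 := congr1 snd E.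
  move: nu la E1 E2 {E} => [nu nu'] [la la'] /= E1 E2.
  by case: E1 => -> ->; case: E2 => _ ->.
- have [/= Ex Ea] := congr1 tag E; case: b / Ea ka E => ka.
  case: y / Ex la => la /Tagged_inj E.
  have /= /mxvec_index_inj E1 := congr1 fst E.
  have /= /mxvec_index_inj E2 := congr1 snd E.
  move: nu la E1 E2 {E} => [nu nu'] [la la'] /= E1 E2.
  by case: E1 => -> ->; case: E2 => ->.
Qed.

End TensorCovering.

Theorem proposition4p1 (Q Q' : quiver) (d : dim_vector Q) (d' : dim_vector Q')
    (d_neq0 : dim_neq0 d) (d'_neq0 : dim_neq0 d') :
  exists S : subquiver (covering (tensor_dim_neq0 d_neq0 d'_neq0)),
    quiver_isomorphic (tensor (covering d_neq0) (covering d'_neq0))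
                      (quiver_of_subquiver S).
Proof.
exists (image_subquiver (tensor_covering_hom d_neq0 d'_neq0)).
apply: inj_hom_isomorphic_image.
- exact: tensor_covering_vertex_inj.
- exact: tensor_covering_arrow_inj.
Qed.
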